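(* Let $k,a\in\mathbb{Z}$ and let $p$ be an (ordinary) prime number with $\gcd(k,p)=1$. Let $\oplus_{kxy}$ be the binary operation on $\mathbb{Z}$ given by $x\oplus_{kxy}y=kxy$. Then $$a^{\oplus^{\leftarrow}_{kxy}p}\oplus_{kxy}1\;\equiv\;a\oplus_{kxy}1\pmod{p}\quad\text{in the sense of } \mathrm{mod}_{\oplus_{kxy}},$$ that is, $p$ is a $\oplus_{kxy}$-factor of the integer $\big(a^{\oplus^{\leftarrow}_{kxy}p}\oplus_{kxy}1\big)-\big(a\oplus_{kxy}1\big)$.
   Context: For a binary operation $\oplus$ on $\mathbb{Z}$, $a^{\oplus^{\leftarrow}p}$ denotes $(a\oplus(a\oplus(\cdots\oplus(a\oplus a)\cdots)))$ in which $a$ occurs exactly $p$ times. A $\oplus$-combination is a formal expression built from elements of $\mathbb{Z}$ by repeatedly forming $(x\oplus y)$; its occurrences are all its subexpressions (including itself and the integers from which it is built). A $\oplus$-representation of $m\in\mathbb{Z}$ is a $\oplus$-combination whose value is $m$. An integer $d$ is a $\oplus$-factor of $m$ if $d$ is an occurrence in some $\oplus$-representation of $m$. $c\equiv b\ (\mathrm{mod}_{\oplus}\ m)$ means that $m$ is a $\oplus$-factor of $c-b$ (ordinary subtraction). *)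

(* Defs.v *)
From mathcomp Require Import all_boot all_order all_algebra.

Set Implicit Arguments.
Unset Strict Implicit.
Unset Printing Implicit Defensive.

Import GRing.Theory.
Local Open Scope ring_scope.

Inductive comb : Type :=
| Leaf of int
| Node of comb & comb.

Fixpoint value (op : int -> int -> int) (e : comb) : int :=
  match e with
  | Leaf n => n
  | Node e1 e2 => op (value op e1) (value op e2)
  end.

Inductive occurrence (s : comb) : comb -> Prop :=
| occ_self : occurrence s s
| occ_left e1 e2 : occurrence s e1 -> occurrence s (Node e1 e2)
| occ_right e1 e2 : occurrence s e2 -> occurrence s (Node e1 e2).

Definition representation (op : int -> int -> int) (m : int) (e : comb) : Prop :=
  value op e = m.

(* "The integer d is an occurrence" is read formally: the expression [Leaf d]
   is a subexpression. *)
Definition op_factor (op : int -> int -> int) (d m : int) : Prop :=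
  exists2 e : comb, representation op m e & occurrence (Leaf d) e.

Definition op_congr (op : int -> int -> int) (m c b : int) : Prop :=
  op_factor op m (c - b).

(* [iterop] nests to the right: op a (op a (... (op a a))), with n copies of a;
   the value at n = 0 is irrelevant. *)
Definition op_rpow (op : int -> int -> int) (a : int) (n : nat) : int :=
  iterop n op a a.

Definition op_kxy (k x y : int) : int := k * x * y.

(* Main.v *)
(* Applying [_ (+) 1] multiplies by [k], which turns the right power of [a] into
   [(k a)^p], so the difference is [(k a)^p - k a]. It is divisible by [k], and
   by [p] thanks to Fermat's little theorem. As [k] and [p] are coprime, it is
   [k p b] for some [b], the value of [p (+) b]. *)
Require Import Defs.
From mathcomp Require Import all_boot all_order all_algebra.

Set Implicit Arguments.
Unset Strict Implicit.
Unset Printing Implicit Defensive.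

Import GRing.Theory.
Local Open Scope ring_scope.

(** In the field with [p] elements, [x ^+ p] is the Frobenius image of [x], and Frobenius fixes the
    image of every integer. *)
Lemma fermat_little_int (p : nat) (z : int) :
  prime p -> (p%:Z %| z ^+ p - z)%Z.
Proof.
move=> p_prime; have charFp := pchar_Fp p_prime.
by rewrite (dvdz_pcharf charFp) rmorphB rmorphXn -(pFrobenius_autE charFp)
  pFrobenius_aut_int subrr.
Qed.

(** The [n] operations joining the [n.+1] copies of [a] supply [n] factors [k]; the outer [k] pairs
    with the remaining copy. *)
Lemma mul_op_rpow_kxy (k a : int) (n : nat) :
  k * op_rpow (op_kxy k) a n.+1 = (k * a) ^+ n.+1.
Proof.
rewrite /op_rpow iteropS; elim: n => [|n IHn] //.
by rewrite iterS {1}/op_kxy mulrCA mulrA -mulrA IHn -exprS.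
Qed.

Lemma op_factor_kxy (k d m : int) : (k * d %| m)%Z -> op_factor (op_kxy k) d m.
Proof.
case/dvdzP=> b ->; exists (Node (Leaf d) (Leaf b)).
  by rewrite /representation /= /op_kxy mulrC.
by apply: occ_left; apply: occ_self.
Qed.

Theorem theorem36 (k a : int) (p : nat) (p_prime : prime p)
    (kp_coprime : gcdz k p%:Z = 1) :
  op_congr (op_kxy k) p%:Z
    (op_kxy k (op_rpow (op_kxy k) a p) 1)
    (op_kxy k a 1).
Proof.
apply: op_factor_kxy; rewrite /op_kxy !mulr1.
rewrite -[in op_rpow _ _ p](prednK (prime_gt0 p_prime)) mul_op_rpow_kxy.
rewrite prednK ?prime_gt0 // Gauss_dvdz; last exact/eqP.
(* What remains is divisibility by [k]: since [p] is positive, a factor [k * a] splits off the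
   power. *)
rewrite fermat_little_int // andbT -[p](prednK (prime_gt0 p_prime)) exprS.
by rewrite rpredB // -?mulrA dvdz_mulr.
Qed.
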